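(* Let $A\in\mathbb{R}^{n\times n}$ be Metzler and Hurwitz stable, $b_0\in\mathbb{R}^n_{\ge0}$, $g_0:=-e_n^TA^{-1}b_0$, $g_n:=-e_n^TA^{-1}e_n$, and $0<\mu<g_0$. For $\alpha,k_p>0$ consider $$\dot x=Ax-k_px_nze_n+b_0,\qquad \dot z=-\alpha z(\mu-e_n^Tx),$$ and its equilibrium with $z^*=\dfrac{g_0-\mu}{g_n\mu k_p}>0$ and $x^*=-A^{-1}(b_0-k_p\mu z^*e_n)$. Then this equilibrium is locally exponentially stable for all $\alpha,k_p>0$.
   Context: $e_i$ standard basis vectors; $x_n=e_n^Tx$. Metzler: all off-diagonal entries nonnegative. Hurwitz stable: all eigenvalues have negative real part. An equilibrium is called locally exponentially stable here if the Jacobian matrix of the vector field at the equilibrium is Hurwitz stable. *)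

(* Defs.v *)
From HB Require Import structures.
From mathcomp Require Import all_boot all_order all_algebra.
From mathcomp Require Import all_classical all_reals.
From mathcomp Require Import topology normedtype derive.
From mathcomp Require Import complex.
Set Implicit Arguments.
Unset Strict Implicit.
Unset Printing Implicit Defensive.
Import Order.TTheory GRing.Theory Num.Theory.
Local Open Scope ring_scope.

Definition en (R : pzRingType) (n : nat) : 'cV[R]_(n.+1) := delta_mx ord_max 0.

Definition Metzler (R : numDomainType) (m : nat) (A : 'M[R]_m) : Prop :=
  forall i j : 'I_m, i != j -> 0 <= A i j.

Definition Hurwitz (R : rcfType) (m : nat) (A : 'M[R]_m) : Prop :=
  forall lam : R[i], eigenvalue (map_mx (real_complex R) A) lam -> complex.Re lam < 0.

(* Locally exponentially stable equilibrium p of the vector field f: the Jacobian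
   matrix of f at p is Hurwitz.  MathComp-Analysis' [jacobian f p] acts on row
   vectors (v *m jacobian f p = 'd f p v), i.e. it is the transpose of the usual
   Jacobian matrix; we transpose it back. *)
Definition loc_exp_stable (R : realType) (m : nat) (f : 'rV[R]_m -> 'rV[R]_m)
  (p : 'rV[R]_m) : Prop := Hurwitz (jacobian f p)^T.

Definition closed_loop (R : realType) (n : nat) (A : 'M[R]_(n.+1)) (b0 : 'cV[R]_(n.+1))
  (alpha kp mu : R) (s : 'rV[R]_(n.+1 + 1)) : 'rV[R]_(n.+1 + 1) :=
  let x : 'cV[R]_(n.+1) := (lsubmx s)^T in
  let z : R := rsubmx s 0 0 in
  row_mx ((A *m x - (kp * x ord_max 0 * z) *: en R n + b0)^T)
         (\row_(j < 1) (- alpha * z * (mu - x ord_max 0))).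

(* Main.v *)
(* Let J be the Jacobian matrix at the equilibrium, whose upper left block is
   A - c e e^T with c = kp zs, and let (u, w) be a left eigenvector of J for lam
   with Re lam >= 0. Then u A = lam u - beta e^T with beta = alpha zs w - c a and
   lam w = - kp mu a, where a = u e. The second equation gives
   Re (w conj a) <= 0, hence Re (beta conj a) <= 0. On the other hand the
   Metzler-Hurwitz matrix A has a vector p > 0 with A p < 0, and comparing u
   with its entrywise modulus forces Re (beta conj a) > 0 unless u = 0. *)
Require Import Defs.
From HB Require Import structures.
From mathcomp Require Import all_boot all_order all_algebra.
From mathcomp Require Import all_classical all_reals.
From mathcomp Require Import topology normedtype derive.
From mathcomp Require Import complex.
From mathcomp Require Import ring lra.
Set Implicit Arguments.
Unset Strict Implicit.
Unset Printing Implicit Defensive.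
Import Order.TTheory GRing.Theory Num.Theory.
Import numFieldNormedType.Exports.
Local Open Scope ring_scope.

Lemma metzler_ge0 (R : realFieldType) (m : nat) (B : 'M[R]_m) (p x : 'cV[R]_m) :
  Metzler B -> (forall i, 0 < p i 0) -> (forall i, (B *m p) i 0 < 0) ->
  (forall i, (B *m x) i 0 <= 0) -> forall i, 0 <= x i 0.
Proof.
move=> BM p0 Bp0 Bx0 i0.
case: (@arg_minP _ _ _ i0 xpredT (fun i => x i 0 / p i 0) isT) => i _ imin.
suff ti : 0 <= x i 0 / p i 0.
  by have := le_trans ti (imin i0 isT); rewrite pmulr_lge0 ?invr_gt0.
rewrite leNgt; apply/negP => ti.
have := Bx0 i; apply/negP; rewrite -ltNge.
apply: (@lt_le_trans _ _ ((x i 0 / p i 0) * (B *m p) i 0)).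
  by rewrite nmulr_rgt0.
rewrite !mxE mulr_sumr; apply: ler_sum => j _; rewrite mulrCA.
have [<-|ij] := eqVneq i j; first by rewrite divfK // gt_eqF.
by apply: ler_wpM2l; [exact: BM|rewrite -ler_pdivlMr // imin].
Qed.

Lemma metzler_gt0 (R : realFieldType) (m : nat) (B : 'M[R]_m) (x : 'cV[R]_m) i :
  Metzler B -> (forall j, 0 <= x j 0) -> (B *m x) i 0 < 0 -> 0 < x i 0.
Proof.
move=> BM x0 Bx; rewrite lt_neqAle x0 andbT eq_sym; apply/negP => /eqP xi.
move: Bx; apply/negP; rewrite -leNgt mxE; apply: sumr_ge0 => j _.
have [<-|ij] := eqVneq i j; first by rewrite xi mulr0.
by rewrite mulr_ge0 // BM.
Qed.

Lemma metzler_shift (R : realFieldType) (m : nat) (A : 'M[R]_m) (t : R) :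
  Metzler A -> Metzler (A - t%:M).
Proof. by move=> AM i j ij; rewrite !mxE (negbTE ij) subr0 AM. Qed.

Lemma mulmx_shift (R : comPzRingType) (m : nat) (A : 'M[R]_m) (t : R) (x : 'cV[R]_m) i :
  ((A - t%:M) *m x) i 0 = (A *m x) i 0 - t * x i 0.
Proof. by rewrite mulmxBl mul_scalar_mx !mxE. Qed.

(* The set of shifts t for which A - t has a positive vector mapped to a negative
   one is an up-set; its infimum cannot be nonnegative, because invertibility of
   A - t lets one solve (A - t) x = -1 there and move slightly further left. *)
Lemma metzler_pos_vector (R : realType) (m : nat) (A : 'M[R]_m) :
  Metzler A -> (forall t, 0 <= t -> A - t%:M \in unitmx) ->
  exists p : 'cV[R]_m, (forall i, 0 < p i 0) /\ (forall i, (A *m p) i 0 < 0).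
Proof.
move=> AM Aunit.
pose S : set R := fun t => exists p : 'cV[R]_m,
  (forall i, 0 < p i 0) /\ (forall i, (A *m p) i 0 < t * p i 0).
suff [p [p0 Ap]] : S 0.
  by exists p; split=> // i; have := Ap i; rewrite mul0r.
apply: contrapT => S0.
have Sge0 t : S t -> 0 <= t.
  move=> [p [p0 Ap]]; rewrite leNgt; apply/negP => t0; apply: S0.
  exists p; split=> // i; apply: (lt_trans (Ap i)).
  by rewrite mul0r pmulr_llt0.
have Sinf : has_inf S.
  split; last by exists 0 => t /Sge0.
  exists (1 + \sum_i `|(A *m (const_mx 1 : 'cV[R]_m)) i 0|), (const_mx 1).
  split=> i; first by rewrite mxE ltr01.
  rewrite [X in _ * X]mxE mulr1.
  rewrite (bigD1 i) //= addrCA; apply: (le_lt_trans (ler_norm _)).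
  by rewrite ltrDl addrC ltr_wpDl // sumr_ge0.
set t0 := inf S.
have t00 : 0 <= t0 by apply: lb_le_inf; [case: Sinf|move=> t /Sge0].
have Ut := Aunit _ t00.
pose x : 'cV[R]_m := - (invmx (A - t0%:M) *m const_mx 1).
have Ax i : (A *m x) i 0 = t0 * x i 0 - 1.
  apply/eqP; rewrite addrC -subr_eq -mulmx_shift.
  by rewrite /x mulmxN mulmxA mulmxV // mul1mx !mxE.
pose e := (1 + \sum_i `|x i 0|)^-1.
have e0 : 0 < e by rewrite invr_gt0 ltr_wpDr // sumr_ge0.
have ex i : e * `|x i 0| < 1.
  rewrite mulrC ltr_pdivrMr ?ltr_wpDr ?sumr_ge0 // mul1r.
  by rewrite (bigD1 i) //= addrCA ltrDl addrC ltr_wpDl // sumr_ge0.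
have x0 : forall i, 0 <= x i 0.
  have [t [p [p0 Ap]] tlt] := inf_adherent e0 Sinf.
  have tge : t0 <= t by apply: (ge_inf (proj2 Sinf)); exists p.
  apply: (@metzler_ge0 _ _ (A - t%:M) p) => // [|i|i]; first exact: metzler_shift.
    by rewrite mulmx_shift subr_lt0.
  rewrite mulmx_shift Ax.
  have : (t - t0) * - x i 0 <= e * `|x i 0|.
    have : - x i 0 <= `|x i 0| by rewrite -normrN ler_norm.
    have : t - t0 <= e by rewrite -/t0 in tlt; lra.
    have := normr_ge0 (x i 0); nra.
  by have := ex i; lra.
have xp i : 0 < x i 0.
  apply: (@metzler_gt0 _ _ (A - t0%:M)) => //; first exact: metzler_shift.
  by rewrite mulmx_shift Ax; lra.
suff /(ge_inf (proj2 Sinf)) : S (t0 - e) by rewrite -/t0; lra.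
exists x; split=> // i; rewrite Ax.
by have := ex i; rewrite (ger0_norm (x0 i)); lra.
Qed.

Lemma hurwitz_shift_unit (R : rcfType) (m : nat) (A : 'M[R]_m) (t : R) :
  Hurwitz A -> 0 <= t -> A - t%:M \in unitmx.
Proof.
move=> AH t0; rewrite -(map_unitmx (real_complex R)) map_mxB map_scalar_mx /=.
apply: contraT => Au; suff /AH /= : eigenvalue (map_mx (real_complex R) A) t%:C%C.
  by rewrite ltNge t0.
by rewrite /eigenvalue /eigenspace kermx_eq0 row_free_unit.
Qed.

Lemma is_diff_linear_row (R : numFieldType) (m : nat) (W : normedModType R)
  (f : {linear 'rV[R]_m -> W}) (a : 'rV[R]_m) : is_diff a f f.
Proof.
have fE : (f : 'rV[R]_m -> W) =
    \sum_(i < m) (fun s : 'rV[R]_m => s 0 i *: f (delta_mx 0 i)).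
  apply/funext => s; rewrite fct_sumE [in LHS](row_sum_delta s) linear_sum.
  by apply: eq_bigr => i _; rewrite linearZ.
have df x : differentiable f x.
  rewrite fE; apply: differentiable_sum => i.
  exact/differentiableZl/differentiable_coord.
apply: DiffDef; first exact: df.
by rewrite diff_lin // => x; exact: differentiable_continuous.
Qed.

Import ComplexField.Normc.

Lemma normc_ge0 (R : rcfType) (z : R[i]) : 0 <= normc z.
Proof. by case: z => a b; exact: sqrtr_ge0. Qed.

Lemma normc_gt0 (R : rcfType) (z : R[i]) : z != 0 -> 0 < normc z.
Proof.
move=> z0; rewrite lt_neqAle normc_ge0 andbT eq_sym.
by apply: contra z0 => /eqP/eq0_normc ->.
Qed.

Lemma Re_mul_conj_le (R : rcfType) (w z : R[i]) :
  complex.Re (w * z^*%C) <= normc w * normc z.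
Proof.
rewrite -lecR; apply: (@le_trans _ _ `|complex.Re (w * z^*%C)|%:C%C).
  by rewrite lecR ler_norm.
by apply: le_trans (normc_ge_Re _) _; rewrite normrM normcJ rmorphM.
Qed.

Lemma Re_mul_conj_self (R : rcfType) (z : R[i]) :
  complex.Re (z * z^*%C) = normc z ^+ 2.
Proof. by case: z => a b /=; rewrite sqr_sqrtr ?addr_ge0 ?sqr_ge0 //; ring. Qed.

Lemma Re_resolvent_column (R : rcfType) (m : nat) (A : 'M[R]_m) (u : 'rV[R[i]]_m)
  (lam : R[i]) (j : 'I_m) :
  Metzler A -> 0 <= complex.Re lam ->
  - (normc (u 0 j) * \sum_i normc (u 0 i) * A i j) <=
  complex.Re ((lam * u 0 j - (u *m map_mx (real_complex R) A) 0 j) * (u 0 j)^*%C).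
Proof.
move=> AM lam0.
have ReM (w z : R[i]) : complex.Re (w * z) =
  complex.Re w * complex.Re z - complex.Im w * complex.Im z by case: w z => ? ? [].
have ImS (z : R[i]) : complex.Im (z * z^*%C) = 0 by case: z => a b /=; ring.
have ReC (w : R[i]) (r : R) : complex.Re (w * r%:C%C) = complex.Re w * r.
  by rewrite ReM /= mulr0 subr0.
rewrite mulrBl -mulrA raddfB /= ReM ImS mulr0 subr0 Re_mul_conj_self mxE.
rewrite mulr_suml raddf_sum /= -[leLHS]add0r; apply: lerD.
  by rewrite mulr_ge0 // sqr_ge0.
rewrite lerN2 mulr_sumr; apply: ler_sum => i _.
rewrite mxE mulrAC ReC mulrCA mulrA.
have [->|ij] := eqVneq i j; first by rewrite Re_mul_conj_self expr2.
by apply: ler_wpM2r; [exact: AM|exact: Re_mul_conj_le].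
Qed.

(* Comparison with |u|: every column of |u| A other than the k-th is nonnegative,
   whereas |u| A p < 0, so the k-th column of |u| A must be negative. *)
Lemma metzler_passive (R : rcfType) (m : nat) (A : 'M[R]_m) (p : 'cV[R]_m)
  (k : 'I_m) (u : 'rV[R[i]]_m) (lam beta : R[i]) :
  Metzler A -> (forall i, 0 < p i 0) -> (forall i, (A *m p) i 0 < 0) ->
  0 <= complex.Re lam -> u != 0 ->
  u *m map_mx (real_complex R) A = lam *: u - beta *: delta_mx 0 k ->
  0 < complex.Re (beta * (u 0 k)^*%C).
Proof.
move=> AM p0 Ap lam0 u0 uA.
pose a : 'rV[R]_m := \row_i normc (u 0 i).
have aE j : (a *m A) 0 j = \sum_i normc (u 0 i) * A i j.
  by rewrite mxE; apply: eq_bigr => i _; rewrite mxE.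
have res j := @Re_resolvent_column R m A u lam j AM lam0.
have offdiag j : u 0 j = 0 -> 0 <= (a *m A) 0 j.
  move=> uj; rewrite aE; apply: sumr_ge0 => i _.
  have [->|ij] := eqVneq i j; first by rewrite uj normc0 mul0r.
  by rewrite mulr_ge0 ?normc_ge0 // AM.
have aA j : j != k -> 0 <= (a *m A) 0 j.
  move=> jk; have [/offdiag//|uj] := eqVneq (u 0 j) 0.
  have nj := normc_gt0 uj.
  have := res j; rewrite -aE uA ![in leRHS]mxE eqxx (negbTE jk) /= mulr0 subr0.
  by rewrite subrr mul0r oppr_le0 pmulr_rge0.
have aAp : (a *m A *m p) 0 0 < 0.
  have [j uj] : exists j, u 0 j != 0 by case/rV0Pn: u0 => i ui; exists i.
  have nj := normc_gt0 uj.
  rewrite -mulmxA mxE (bigD1 j) //= -[ltRHS]addr0; apply: ltr_leD.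
    by rewrite mxE pmulr_rlt0.
  apply: sumr_le0 => i _; rewrite mxE mulr_ge0_le0 ?normc_ge0 //.
  exact/ltW.
have aAk : (a *m A) 0 k < 0.
  rewrite ltNge; apply/negP => aAk; move: aAp; apply/negP; rewrite -leNgt.
  rewrite mxE; apply: sumr_ge0 => j _; apply: mulr_ge0; last exact/ltW.
  by have [->//|/aA] := eqVneq j k.
have uk : u 0 k != 0 by apply: contraTN aAk => /eqP/offdiag; rewrite -leNgt.
have nk := normc_gt0 uk.
have := res k; rewrite -aE uA ![in leRHS]mxE !eqxx /= mulr1 opprB addrC subrK.
by apply: lt_le_trans; rewrite oppr_gt0 pmulr_rlt0.
Qed.

Lemma mulmx_en (R : pzRingType) (n : nat) (u : 'rV[R]_(n.+1)) :
  u *m en R n = (u 0 ord_max)%:M.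
Proof. by rewrite -colE [LHS]mx11_scalar mxE. Qed.

Lemma hurwitz_feedback (R : realType) (n : nat) (A : 'M[R]_(n.+1)) (c d b : R) :
  Metzler A -> Hurwitz A -> 0 < c -> 0 < d -> 0 < b ->
  Hurwitz (block_mx (A - c *: (en R n *m (en R n)^T)) (- (b *: en R n))
                    (d *: (en R n)^T) (0 : 'M[R]_1)).
Proof.
move=> AM AH c0 d0 b0 lam /eigenvalueP [v].
rewrite -[v]hsubmxK; move: (lsubmx v) (rsubmx v) => u w {v}.
rewrite map_block_mx mul_row_block scale_row_mx => /eq_row_mx [].
have [p [p0 Ap]] := metzler_pos_vector AM (fun t => @hurwitz_shift_unit _ _ A t AH).
rewrite ltNge => uE wE uw0; apply/negP => lam0.
have enT (F : pzRingType) : (en F n)^T = delta_mx 0 ord_max by rewrite trmx_delta.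
have wlam : - (b%:C%C * u 0 ord_max) = lam * w 0 0.
  move: wE; rewrite map_mxN map_mxZ map_delta_mx -/(en R[i] n) map_mx0 mulmx0 addr0.
  rewrite mulmxN -scalemxAr mulmx_en => /matrixP/(_ 0 0).
  by rewrite !mxE eqxx /= mulr1n.
have uA : u *m map_mx (real_complex R) A = lam *: u -
    (d%:C%C * w 0 0 - c%:C%C * u 0 ord_max) *: delta_mx 0 ord_max.
  apply/eqP; rewrite eq_sym subr_eq -uE; apply/eqP.
  rewrite map_mxB !map_mxZ map_mxM -map_trmx map_delta_mx -/(en R[i] n).
  rewrite mulmxBr -!scalemxAr mulmxA mulmx_en enT mul_scalar_mx.
  rewrite [w in LHS]mx11_scalar mul_scalar_mx !scalerA scalerBl.
  by rewrite -addrA; congr (_ + _); rewrite addrC.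
have [u0|u0] := eqVneq u 0.
  have /eqP := uA; rewrite u0 mul0mx scaler0 sub0r eq_sym oppr_eq0 !mxE mulr0 subr0.
  rewrite scaler_eq0 mulf_eq0 => /orP[/orP[/eqP[/eqP]|/eqP w0]|/eqP/matrixP/(_ 0 ord_max)/eqP].
  - by rewrite gt_eqF.
  - move/negP: uw0; apply; rewrite u0 [w]mx11_scalar w0 raddf0 row_mx0 //.
  - by rewrite !mxE !eqxx oner_eq0.
have := metzler_passive AM p0 Ap lam0 u0 uA.
move: wlam lam0 {uE wE uA}; case: (u 0 ord_max) (w 0 0) lam => [a1 a2] [w1 w2] [l1 l2] /=.
move=> [] h1 h2 lam0.
move=> Rebeta.
have : 0 <= b * - (w1 * a1 + w2 * a2).
  have -> : b * - (w1 * a1 + w2 * a2) =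
    w1 * - (b * a1 - 0 * a2) + w2 * - (b * a2 + 0 * a1) by ring.
  have -> : w1 * - (b * a1 - 0 * a2) + w2 * - (b * a2 + 0 * a1) =
    l1 * (w1 ^+ 2 + w2 ^+ 2) by rewrite h1 h2; ring.
  by rewrite mulr_ge0 // addr_ge0 // sqr_ge0.
rewrite pmulr_rge0 // => /(mulr_ge0 (ltW d0)) dwa.
have := mulr_ge0 (ltW c0) (addr_ge0 (sqr_ge0 a1) (sqr_ge0 a2)).
by clear -Rebeta dwa; lra.
Qed.

Lemma jacobian_closed_loop (R : realType) (n : nat) (A : 'M[R]_(n.+1))
  (b0 : 'cV[R]_(n.+1)) (alpha kp mu z : R) (x : 'cV[R]_(n.+1)) :
  x ord_max 0 = mu ->
  (jacobian (closed_loop A b0 alpha kp mu) (row_mx x^T (\row_(j < 1) z)))^T =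
  block_mx (A - (kp * z) *: (en R n *m (en R n)^T)) (- ((kp * mu) *: en R n))
           ((alpha * z) *: (en R n)^T) 0.
Proof.
move=> xmu; set pt := row_mx _ _.
pose i : 'I_(n.+1 + 1) := lshift 1 ord_max.
pose j : 'I_(n.+1 + 1) := rshift n.+1 ord0.
pose L : 'M[R]_(n.+1 + 1) := block_mx A^T 0 0 (- (alpha * mu))%:M.
pose w : 'rV[R]_(n.+1 + 1) := row_mx (- (kp *: (en R n)^T)) alpha%:M.
pose c : 'rV[R]_(n.+1 + 1) := row_mx b0^T 0.
pose co k : 'rV[R]_(n.+1 + 1) -> R := fun s => s 0 k.
have fE : closed_loop A b0 alpha kp mu =
    (mulmxr L : _ -> 'rV[R]_(n.+1 + 1)) + (fun s => (co i * co j) s *: w) + cst c.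
  apply/funext => s; rewrite -[s]hsubmxK.
  move: (lsubmx s) (rsubmx s) => u v.
  rewrite /closed_loop /= row_mxKl row_mxKr !fctE /co /i /j row_mxEl row_mxEr.
  rewrite /= /L mul_row_block !mulmx0 addr0 add0r scale_row_mx !add_row_mx.
  congr row_mx.
    rewrite !linearD linearN linearZ /= trmx_mul trmxK mxE scalerN scalerA.
    by congr (_ - _ *: _ + _); ring.
  apply/matrixP => k l; rewrite !ord1 addr0 !mxE big_ord1 !mxE !eqxx !mulr1n.
  ring.
have dco k (a : 'rV[R]_(n.+1 + 1)) : is_diff a (co k) (co k).
  have co_lin : linear (co k) by move=> r s t; rewrite /co !mxE.
  pose ls := GRing.isLinear.Build _ _ _ _ (co k) co_lin.
  pose cl : {linear 'rV[R]_(n.+1 + 1) -> R} := HB.pack (co k) ls.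
  exact: (is_diff_linear_row cl a).
have df : is_diff pt (closed_loop A b0 alpha kp mu)
  ((mulmxr L : _ -> 'rV[R]_(n.+1 + 1)) +
   (fun h => (co i pt * co j h + co j pt * co i h) *: w)).
  have dL := is_diff_linear_row
    (mulmxr L : {linear 'rV[R]_(n.+1 + 1) -> 'rV[R]_(n.+1 + 1)}) pt.
  have dM := is_diffM (dco i pt) (dco j pt).
  have dq : is_diff pt (fun s => (co i * co j) s *: w)
      (fun h => (co i pt * co j h + co j pt * co i h) *: w).
    apply: DiffDef; first exact/differentiableZl/ex_diff.
    by rewrite diffZl; [rewrite diff_val|exact: ex_diff].
  have := is_diffD (is_diffD dL dq) (is_diff_cst c pt).
  by rewrite fE addr0.
apply: trmx_inj; rewrite trmxK; apply/row_matrixP => k.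
rewrite 2!rowE /jacobian mul_rV_lin1 /= diff_val.
move: (delta_mx _ _) => h; rewrite -[h]hsubmxK.
move: (lsubmx h) (rsubmx h) => u v.
rewrite !fctE /co /i /j /pt !row_mxEl !row_mxEr /= /L tr_block_mx !mul_row_block.
rewrite !mulmx0 addr0 add0r scale_row_mx !add_row_mx !mxE xmu.
have trZ p q (r : R) (M : 'M[R]_(p, q)) : (r *: M)^T = r *: M^T by exact: linearZ.
have -> : u *m (A - (kp * z) *: (en R n *m (en R n)^T))^T =
    u *m A^T - (kp * z * u 0 ord_max) *: (en R n)^T.
  rewrite (raddfB trmx) /= mulmxBr trZ trmx_mul trmxK.
  by rewrite -scalemxAr mulmxA mulmx_en mul_scalar_mx scalerA.
have -> : v *m (- ((kp * mu) *: en R n))^T = - ((kp * mu * v 0 0) *: (en R n)^T).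
  rewrite (raddfN trmx) /= mulmxN trZ -scalemxAr.
  by rewrite [v in LHS]mx11_scalar mul_scalar_mx scalerA.
have -> : u *m ((alpha * z) *: (en R n)^T)^T = ((alpha * z) * u 0 ord_max)%:M.
  by rewrite trZ trmxK -scalemxAr mulmx_en scale_scalar_mx.
congr row_mx.
  rewrite -addrA -opprD -scalerDl scalerN scalerA; congr (_ - _ *: _).
  by rewrite ord1; ring.
rewrite trmx0 mulmx0 addr0; apply/matrixP => a b.
rewrite !ord1 !mxE big_ord1 !mxE !eqxx !mulr1n; ring.
Qed.

Theorem mainTheorem17 (R : realType) (n : nat) (A : 'M[R]_(n.+1)) (b0 : 'cV[R]_(n.+1))
  (mu : R) :
  Metzler A -> Hurwitz A -> (forall i, 0 <= b0 i 0) ->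
  let g0 := - ((en R n)^T *m invmx A *m b0) 0 0 in
  let gn := - ((en R n)^T *m invmx A *m en R n) 0 0 in
  0 < mu -> mu < g0 ->
  forall alpha kp : R, 0 < alpha -> 0 < kp ->
  let zs := (g0 - mu) / (gn * mu * kp) in
  let xs := - (invmx A *m (b0 - (kp * mu * zs) *: en R n)) in
  loc_exp_stable (closed_loop A b0 alpha kp mu) (row_mx xs^T (\row_(j < 1) zs)).
Proof.
move=> AM AH _ g0 gn mu0 mug0 alpha kp alpha0 kp0 zs xs.
have Aunit t : 0 <= t -> A - t%:M \in unitmx by exact: hurwitz_shift_unit.
have [p [p0 Ap]] := metzler_pos_vector AM Aunit.
have AU : A \in unitmx by have := Aunit 0 (lexx 0); rewrite raddf0 subr0.
have enTE (y : 'cV[R]_(n.+1)) : ((en R n)^T *m y) 0 0 = y ord_max 0.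
  by rewrite trmx_delta -rowE mxE.
have gn0 : 0 < gn.
  pose y : 'cV[R]_(n.+1) := - (invmx A *m en R n).
  have Ay : A *m y = - en R n by rewrite mulmxN mulmxA mulmxV // mul1mx.
  have -> : gn = y ord_max 0 by rewrite /gn -mulmxA enTE !mxE.
  apply: (metzler_gt0 AM); last by rewrite Ay !mxE !eqxx ltrN10.
  by apply: (metzler_ge0 AM p0 Ap) => i; rewrite Ay !mxE oppr_le0 ler0n.
have zs0 : 0 < zs by rewrite divr_gt0 ?subr_gt0 // !mulr_gt0.
have xsmu : xs ord_max 0 = mu.
  rewrite /xs -enTE mulmxN mulmxA mulmxBr -scalemxAr.
  have -> : forall (M N : 'M[R]_1) r, (- (M - r *: N)) 0 0 = - M 0 0 - r * - N 0 0.
    by move=> M N r; rewrite !mxE; ring.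
  rewrite -/g0 -/gn /zs; field.
  by rewrite !gt_eqF.
rewrite /loc_exp_stable jacobian_closed_loop //.
by apply: hurwitz_feedback => //; rewrite mulr_gt0.
Qed.
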